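(* Let $\mathcal{C}$ be a small category and let $I$ be an ideal of $\widehat{\mathcal{C}}$. Then the weak Grothendieck topology $\mathbf{J}^I$ on $\mathcal{C}$ associated to the ideal closure operator $C^I$ is given by $$\mathbf{J}^I(C)=\{T_C\in\Omega(C)\mid I_C\subseteq T_C\}$$ for any $C\in\mathcal{C}$. Furthermore, the weak topology $j^I:\Omega\to\Omega$ on $\widehat{\mathcal{C}}$ associated to $C^I$ is given by $$j^I_C(S_C)=\{f\mid C_f=C,\ \forall g\in I_{D_f},\ fg\in S_C\}$$ for any $C\in\mathcal{C}$ and any $S_C\in\Omega(C)$. Moreover, $j^I$ is a (Lawvere--Tierney) topology on $\widehat{\mathcal{C}}$ if and only if $I$ is idempotent, i.e. $I^2=I$.
   Context: $\widehat{\mathcal{C}}$ is the category of presheaves of sets on $\mathcal{C}$, and $\Omega$ its subobject classifier: $\Omega(C)$ is the set of sieves on $C$, and $\Omega(g)(S)=g^*(S)=\{h\mid gh\in S\}$. For an arrow $f$, $D_f$ is its domain and $C_f$ its codomain; $t(C)$ is the maximal sieve on $C$. An ideal $I$ of $\widehat{\mathcal{C}}$ is a subfunctor of the Yoneda functor $\mathbf{y}:\mathcal{C}\to\widehat{\mathcal{C}}$; equivalently, a family $\{I_C\}_{C\in\mathcal{C}}$ such that each $I_C$ is a sieve on $C$ and for any arrow $f:C\to D$ and any $g\in I_C$ one has $fg\in I_D$. The ideal $I^2$ is given by $I^2(C)=\{fg\mid f\in I_C,\ g\in I_{D_f}\}$. The ideal closure operator $C^I$ is given, for a presheaf $F$ and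 a subpresheaf $G$ of $F$, by $C^I_F(G)(C)=\{x\in F(C)\mid \forall f\in I_C,\ F(f)(x)\in G(D_f)\}$; it is a modal closure operator (extensive, monotone, and commuting with pullback along arrows of $\widehat{\mathcal{C}}$). A weak topology on $\widehat{\mathcal{C}}$ is a morphism $j:\Omega\to\Omega$ with $j\circ\mathrm{true}=\mathrm{true}$ and $j\circ\wedge\le\wedge\circ(j\times j)$, i.e. $j_C(S\cap T)\subseteq j_C(S)\cap j_C(T)$; a (Lawvere--Tierney) topology is a morphism $j$ with $j\circ\mathrm{true}=\mathrm{true}$, $j\circ j=j$, $j\circ\wedge=\wedge\circ(j\times j)$. Modal closure operators $\overline{(\cdot)}$, weak topologies $j$ and weak Grothendieck topologies $\mathbf{J}$ correspond bijectively: $j$ is the characteristic map of the closure of the subobject $\mathrm{true}:1\rightarrowtail\Omega$ (equivalently, the characteristic map of $\overline{G}\rightarrowtail F$ is $j$ composed with that of $G\rightarrowtail F$), and $\mathbf{J}(C)=\{S\in\Omega(C)\mid j_C(S)=t(C)\}$. *)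

(* Defs.v *)
From mathcomp Require Import all_boot boolp classical_sets.

Set Implicit Arguments.
Unset Strict Implicit.
Unset Printing Implicit Defensive.

Local Open Scope classical_set_scope.

Declare Scope psh_scope.
Delimit Scope psh_scope with psh.
Local Open Scope psh_scope.

(* Composition is in applicative order: [f ∘ g] is f after g, written fg in
   the literature on sieves. *)
Record category := Category {
  ob :> Type;
  hom : ob -> ob -> Type;
  idc : forall X, hom X X;
  compc : forall X Y Z, hom Y Z -> hom X Y -> hom X Z;
  comp1c : forall X Y (f : hom X Y), compc (idc Y) f = f;
  compc1 : forall X Y (f : hom X Y), compc f (idc X) = f;
  compcA : forall W X Y Z (f : hom Y Z) (g : hom X Y) (h : hom W X),
    compc f (compc g h) = compc (compc f g) h
}.
Arguments idc {c} X.
Arguments compc {c X Y Z} f g.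
Notation "f ∘ g" := (compc f g) (at level 40, left associativity) : psh_scope.

Record presheaf (C : category) := Presheaf {
  psh_ob :> C -> Type;
  psh_map : forall X Y : C, hom X Y -> psh_ob Y -> psh_ob X;
  psh_map1 : forall (X : C) (x : psh_ob X), psh_map (idc X) x = x;
  psh_mapM : forall (X Y Z : C) (f : hom Y Z) (g : hom X Y) (x : psh_ob Z),
    psh_map (f ∘ g) x = psh_map g (psh_map f x)
}.
Arguments psh_map {C} p {X Y} f x.

Record psh_hom (C : category) (F G : presheaf C) := PshHom {
  psh_fun :> forall X : C, F X -> G X;
  psh_nat : forall (X Y : C) (f : hom X Y) (x : F Y),
    psh_fun (psh_map F f x) = psh_map G f (psh_fun x)
}.
Arguments psh_fun {C F G} p X x.

Record subpresheaf (C : category) (F : presheaf C) := Subpresheaf {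
  sub_set :> forall X : C, set (F X);
  sub_stable : forall (X Y : C) (f : hom X Y) (x : F Y),
    sub_set x -> sub_set (psh_map F f x)
}.
Arguments sub_set {C F} s X _.

Definition sub_le (C : category) (F : presheaf C) (G H : subpresheaf F) :=
  forall X : C, G X `<=` H X.

Lemma subpresheaf_eq (C : category) (F : presheaf C) (G H : subpresheaf F) :
  (forall X : C, G X = H X) -> G = H.
Proof.
case: G H => [g gP] [h hP] /= gh.
have {}gh : g = h by apply: functional_extensionality_dep.
by subst h; congr Subpresheaf; apply: Prop_irrelevance.
Qed.

Definition sub_pullback (C : category) (F G : presheaf C) (phi : psh_hom F G)
  (H : subpresheaf G) : subpresheaf F.
Proof.
refine (@Subpresheaf C F (fun X => [set x | H X (phi X x)]) _).
by move=> X Y f x /= Hx; rewrite psh_nat; apply: sub_stable.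
Defined.

(* An arrow with codomain X is given by its domain D and an element of
   [hom D X], so a set of such arrows is a family of sets indexed by D. *)
Record sieve (C : category) (X : C) := Sieve {
  sieve_set :> forall D : C, set (hom D X);
  sieve_stable : forall (D E : C) (f : hom D X) (g : hom E D),
    sieve_set f -> sieve_set (f ∘ g)
}.
Arguments sieve_set {C X} s D _.

Lemma sieve_eq (C : category) (X : C) (S T : sieve X) :
  (forall D : C, S D = T D) -> S = T.
Proof.
case: S T => [s sP] [t tP] /= st.
have {}st : s = t by apply: functional_extensionality_dep.
by subst t; congr Sieve; apply: Prop_irrelevance.
Qed.

Definition sieve_le (C : category) (X : C) (S T : sieve X) :=
  forall D : C, S D `<=` T D.

Definition maxsieve (C : category) (X : C) : sieve X :=
  @Sieve C X (fun=> setT) (fun _ _ _ _ _ => I).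

Definition sieveI (C : category) (X : C) (S T : sieve X) : sieve X.
Proof.
refine (@Sieve C X (fun D => S D `&` T D) _).
by move=> D E f g [Sf Tf]; split; apply: sieve_stable.
Defined.

Definition sieve_pull (C : category) (X Y : C) (g : hom Y X) (S : sieve X) :
  sieve Y.
Proof.
refine (@Sieve C Y (fun D => [set h | S D (g ∘ h)]) _).
by move=> D E h k /= Sh; rewrite compcA; apply: sieve_stable.
Defined.

Definition Omega (C : category) : presheaf C.
Proof.
refine (@Presheaf C (@sieve C) (fun X Y f S => sieve_pull f S) _ _).
- by move=> X S; apply: sieve_eq => D; apply/seteqP; split=> h /=;
    rewrite comp1c.
- by move=> X Y Z f g S; apply: sieve_eq => D; apply/seteqP; split=> h /=;
    rewrite compcA.
Defined.

(* The subobject of Omega represented by true : 1 -> Omega. *)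
Definition true_sub (C : category) : subpresheaf (Omega C).
Proof.
refine (@Subpresheaf C (Omega C) (fun X => [set maxsieve X]) _).
by move=> X Y f S /= ->; apply: sieve_eq.
Defined.

Definition char_sieve (C : category) (F : presheaf C) (G : subpresheaf F)
  (X : C) (x : F X) : sieve X.
Proof.
refine (@Sieve C X (fun D => [set f | G D (psh_map F f x)]) _).
by move=> D E f g /= Gf; rewrite psh_mapM; apply: sub_stable.
Defined.

Definition char_map (C : category) (F : presheaf C) (G : subpresheaf F) :
  psh_hom F (Omega C).
Proof.
refine (@PshHom C F (Omega C) (fun X => @char_sieve C F G X) _).
by move=> X Y f x; apply: sieve_eq => D; apply/seteqP; split=> h /=;
  rewrite psh_mapM.
Defined.

(* The defining property of the subobject classifier. *)
Lemma char_mapP (C : category) (F : presheaf C) (G : subpresheaf F)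
    (phi : psh_hom F (Omega C)) :
  sub_pullback phi (true_sub C) = G <->
  forall (X : C) (x : F X), phi X x = char_map G X x.
Proof.
split=> [<- X x|phiE].
  apply: sieve_eq => D; apply/seteqP; split=> f /=; rewrite psh_nat => fS.
    by apply: sieve_eq => E; apply/seteqP; split=> // h _; apply: sieve_stable.
  have : sieve_set (psh_map (Omega C) f (phi X x) : sieve D) D (idc D).
    by rewrite fS.
  by rewrite /= compc1.
apply: subpresheaf_eq => X; apply/seteqP; split=> x /=; rewrite phiE => h.
  have : sieve_set (char_map G X x) X (idc X) by rewrite h.
  by rewrite /= psh_map1.
by apply: sieve_eq => D; apply/seteqP; split=> // f _ /=; apply: sub_stable.
Qed.

Record modal_closure (C : category) := ModalClosure {
  closure_op :> forall F : presheaf C, subpresheaf F -> subpresheaf F;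
  closure_ext : forall (F : presheaf C) (G : subpresheaf F),
    sub_le G (closure_op G);
  closure_mono : forall (F : presheaf C) (G H : subpresheaf F),
    sub_le G H -> sub_le (closure_op G) (closure_op H);
  closure_pull : forall (F G : presheaf C) (phi : psh_hom F G)
      (H : subpresheaf G),
    closure_op (sub_pullback phi H) = sub_pullback phi (closure_op H)
}.
Arguments closure_op {C} m F G.

Record weak_topology (C : category) := WeakTopology {
  wt_hom :> psh_hom (Omega C) (Omega C);
  wt_true : forall X : C, wt_hom X (maxsieve X) = maxsieve X;
  wt_meet : forall (X : C) (S T : sieve X),
    sieve_le (wt_hom X (sieveI S T)) (sieveI (wt_hom X S) (wt_hom X T))
}.

Definition is_topology (C : category) (j : psh_hom (Omega C) (Omega C)) :=
  [/\ forall X : C, j X (maxsieve X) = maxsieve X,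
      forall (X : C) (S : sieve X), j X (j X S) = j X S
    & forall (X : C) (S T : sieve X),
        j X (sieveI S T) = sieveI (j X S) (j X T)].

(* Under J(X) = {S | j_X(S) = maxsieve}, stability is naturality of j, and
   upward closure is the inequality j (S ∧ T) <= j S ∧ j T. *)
Record weak_grothendieck (C : category) := WeakGrothendieck {
  wg_cover :> forall X : C, set (sieve X);
  wg_max : forall X : C, wg_cover (maxsieve X);
  wg_stable : forall (X Y : C) (g : hom Y X) (S : sieve X),
    wg_cover S -> wg_cover (sieve_pull g S);
  wg_up : forall (X : C) (S T : sieve X),
    sieve_le S T -> wg_cover S -> wg_cover T
}.
Arguments wg_cover {C} w X _.

Definition yoneda (C : category) (X : C) : presheaf C.
Proof.
refine (@Presheaf C (fun D => hom D X) (fun D E f g => g ∘ f) _ _).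
- by move=> D f; apply: compc1.
- by move=> D E G f g h; apply: compcA.
Defined.

Definition sieve_sub (C : category) (X : C) (S : sieve X) :
  subpresheaf (yoneda X) :=
  @Subpresheaf C (yoneda X) S (fun D E g f Sf => @sieve_stable C X S E D f g Sf).

Lemma closure_true_mono (C : category) (c : modal_closure C) (X : C)
    (S T : sieve X) : sieve_le S T ->
  c (Omega C) (true_sub C) X S -> c (Omega C) (true_sub C) X T.
Proof.
have closedP (U : sieve X) :
    c (Omega C) (true_sub C) X U =
    c (yoneda X) (sieve_sub U) X (idc X).
  pose u : psh_hom (yoneda X) (Omega C) :=
    char_map (sieve_sub U).
  have <- : sub_pullback u (true_sub C) = sieve_sub U.
    by apply/char_mapP.
  rewrite closure_pull /=; congr sub_set.
  by apply: sieve_eq => D; apply/seteqP; split=> h /=; rewrite comp1c.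
by move=> ST; rewrite !closedP; apply: closure_mono.
Qed.

(* The characteristic map of the closure of true : 1 -> Omega. *)
Definition weak_topology_of_closure (C : category) (c : modal_closure C) :
  weak_topology C.
Proof.
refine (@WeakTopology C (char_map (c (Omega C) (true_sub C))) _ _).
- move=> X; apply: sieve_eq => D; apply/seteqP; split=> // f _ /=.
  by apply: closure_ext; apply: sieve_eq.
- by move=> X S T D f /= fST; split; apply: closure_true_mono fST => E h /= [].
Defined.

Definition weak_grothendieck_of_topology (C : category) (j : weak_topology C) :
  weak_grothendieck C.
Proof.
refine (@WeakGrothendieck C (fun X => [set S | j X S = maxsieve X]) _ _ _).
- by move=> X; apply: wt_true.
- move=> X Y g S /= jS; have /= -> := psh_nat j g S.
  by rewrite jS; apply: sieve_eq.
- move=> X S T ST /= jS; apply: sieve_eq => D; apply/seteqP; split=> // f _.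
  have ST_S : sieveI S T = S.
    apply: sieve_eq => E; apply/seteqP; split=> h /=; first by case.
    by split=> //; apply: ST.
  by have /(_ D f) := @wt_meet C j X S T; rewrite ST_S jS => /(_ Logic.I) [].
Defined.

(* A subfunctor of the Yoneda functor: subpresheaves of the representables,
   i.e. sieves, preserved by postcomposition. *)
Record ideal (C : category) := Ideal {
  ideal_sieve :> forall X : C, sieve X;
  ideal_stable : forall (X Y D : C) (f : hom X Y) (g : hom D X),
    ideal_sieve X D g -> ideal_sieve Y D (f ∘ g)
}.

Lemma ideal_eq (C : category) (I J : ideal C) :
  (forall X : C, I X = J X) -> I = J.
Proof.
case: I J => [i iP] [j jP] /= ij.
have {}ij : i = j by apply: functional_extensionality_dep.
by subst j; congr Ideal; apply: Prop_irrelevance.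
Qed.

Definition ideal_sq_sieve (C : category) (I : ideal C) (X : C) : sieve X.
Proof.
refine (@Sieve C X (fun D => [set h |
  exists (Y : C) (f : hom Y X) (g : hom D Y),
    [/\ I X Y f, I Y D g & h = f ∘ g]]) _).
move=> D E h k /= [Y [f [g [If Ig ->]]]]; exists Y, f, (g ∘ k); split=> //.
- exact: sieve_stable.
- by rewrite compcA.
Defined.

Definition ideal_sq (C : category) (I : ideal C) : ideal C.
Proof.
refine (@Ideal C (@ideal_sq_sieve C I) _).
move=> X Y D k h /= [Z [f [g [If Ig ->]]]]; exists Z, (k ∘ f), g; split=> //.
- exact: ideal_stable.
- by rewrite compcA.
Defined.

Definition ideal_closure_sub (C : category) (I : ideal C) (F : presheaf C)
  (G : subpresheaf F) : subpresheaf F.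
Proof.
refine (@Subpresheaf C F
  (fun X => [set x | forall (D : C) (f : hom D X),
    I X D f -> G D (psh_map F f x)]) _).
move=> X Y h x /= Gx D f If; rewrite -psh_mapM; apply: Gx.
exact: ideal_stable.
Defined.

Definition ideal_closure (C : category) (I : ideal C) : modal_closure C.
Proof.
refine (@ModalClosure C (@ideal_closure_sub C I) _ _ _).
- by move=> F G X x Gx D f _; apply: sub_stable.
- by move=> F G H GH X x Gx D f If; apply: GH; apply: Gx.
- move=> F G phi H; apply: subpresheaf_eq => X.
  by apply/seteqP; split=> x /= Hx D f If; move: (Hx D f If); rewrite psh_nat.
Defined.

Definition ideal_topology (C : category) (I : ideal C) : weak_topology C :=
  weak_topology_of_closure (ideal_closure I).

Definition ideal_grothendieck (C : category) (I : ideal C) :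
  weak_grothendieck C :=
  weak_grothendieck_of_topology (ideal_topology I).

(* Main.v *)
Require Import Defs.
From mathcomp Require Import all_boot boolp classical_sets.
Local Open Scope classical_set_scope.
Local Open Scope psh_scope.

(** By the formula for [j^I], a composite [j^I (j^I S)] tests [S] on the
    arrows of [I^2], so [j^I ∘ j^I = j^(I^2)], and [I^2 = I] makes [j^I]
    idempotent. Conversely, [I^2 X] belongs to [J^(I^2) X]; if [j^I] is
    idempotent then it belongs to [J^I X], which says that [I X] is contained
    in [I^2 X]. *)

(** Any [f] into [X] factors as [idc X ∘ f]. This reduces maximality to a single membership. *)
Lemma maxsieveP (C : category) (X : C) (S : sieve X) :
  S = maxsieve X <-> S X (idc X).
Proof.
split=> [->//|S1]; apply: sieve_eq => D; apply/seteqP; split=> // f _.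
by rewrite -(comp1c f); apply: sieve_stable.
Qed.

(** By definition, [f] lies in $j^I(S)$ when the pullback of [S] along [f ∘ g] is maximal for each
    [g] in [I D]; testing this at the identity gives the formula. *)
Lemma ideal_topologyE (C : category) (I : ideal C) (X : C) (S : sieve X)
    (D : C) :
  ideal_topology I X S D =
  [set f : hom D X | forall (E : C) (g : hom E D), I D E g -> S E (f ∘ g)].
Proof.
apply/seteqP; split=> f /= jf E g Ig.
  by have /maxsieveP := jf E g Ig; rewrite /= compc1.
by apply/maxsieveP; rewrite /= compc1; apply: jf.
Qed.

(** This is the formula for $j^I$ at [f = idc X]. *)
Lemma ideal_grothendieckE (C : category) (I : ideal C) (X : C) :
  ideal_grothendieck I X = [set T : sieve X | sieve_le (I X) T].
Proof.
apply/seteqP; split=> T.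
  move=> /maxsieveP; rewrite ideal_topologyE /= => IT D f If.
  by rewrite -(comp1c f); apply: IT.
move=> /= IT; apply/maxsieveP; rewrite ideal_topologyE /= => D f If.
by rewrite comp1c; apply: IT.
Qed.

(** Universal quantification commutes with conjunction, so among the topology axioms only
    idempotence of $j^I$ depends on the ideal. *)
Lemma ideal_topologyI (C : category) (I : ideal C) (X : C) (S T : sieve X) :
  ideal_topology I X (sieveI S T) =
  sieveI (ideal_topology I X S) (ideal_topology I X T).
Proof.
apply: sieve_eq => D.
rewrite -[RHS]/(ideal_topology I X S D `&` ideal_topology I X T D).
rewrite !ideal_topologyE; apply/seteqP; split=> f /=.
  by move=> STf; split=> E g Ig; have [] := STf E g Ig.
by move=> [Sf Tf] E g Ig; split; [apply: Sf|apply: Tf].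
Qed.

Lemma ideal_topology_sq (C : category) (I : ideal C) (X : C) (S : sieve X) :
  ideal_topology I X (ideal_topology I X S) = ideal_topology (ideal_sq I) X S.
Proof.
apply: sieve_eq => D; rewrite !ideal_topologyE.
apply/seteqP; split=> f jf.
  move=> E _ [Y [g [h [Ig Ih ->]]]].
  by have := jf Y g Ig; rewrite ideal_topologyE /= compcA; apply.
move=> Y g Ig; rewrite ideal_topologyE /= => E h Ih.
by rewrite -compcA; apply: jf; exists Y, g, h.
Qed.

Lemma ideal_sq_le (C : category) (I : ideal C) (X : C) :
  sieve_le (ideal_sq I X) (I X).
Proof. by move=> D _ [Y [f [g [_ Ig ->]]]]; apply: ideal_stable. Qed.

Theorem corollary2p6 (C : category) (I : ideal C) :
  [/\ forall X : C,
        ideal_grothendieck I X = [set T : sieve X | sieve_le (I X) T],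
      forall (X : C) (S : sieve X) (D : C),
        ideal_topology I X S D =
        [set f : hom D X |
          forall (E : C) (g : hom E D), I D E g -> S E (f ∘ g)]
    & is_topology (ideal_topology I) <-> ideal_sq I = I].
Proof.
split; [exact: ideal_grothendieckE|exact: ideal_topologyE|split].
  move=> [_ jj _]; apply: ideal_eq => X; apply: sieve_eq => D.
  apply/seteqP; split; first exact: ideal_sq_le.
  have : ideal_grothendieck (ideal_sq I) X (ideal_sq I X).
    by rewrite ideal_grothendieckE => D' f.
  have -> : ideal_grothendieck (ideal_sq I) X = ideal_grothendieck I X.
    (* Covering means that $j(S)$ is maximal, and $j^{I^2}(S) = j^I(j^I(S)) = j^I(S)$. *)
    by apply: funext => S; rewrite -[LHS]/(_ = _) -ideal_topology_sq jj.
  by rewrite ideal_grothendieckE; apply.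
move=> II; split; [exact: wt_true| |exact: ideal_topologyI].
by move=> X S; rewrite ideal_topology_sq II.
Qed.
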